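(* Let $\mathbb{K}$ be a field and let $I$ be a squarefree monomial ideal of $S=\mathbb{K}[x_1,\ldots,x_n]$. Then $${\rm sdepth}(I)\geq n-{\rm sv}(I)+1 \quad\text{and}\quad {\rm sdepth}(S/I)\geq n-{\rm sv}(I),$$ where ${\rm sv}(I)$ is the Schmitt--Vogel number of $I$.
   Context: Schmitt--Vogel number: for a nonzero monomial ideal $I$, let ${\rm Mon}(I)$ be the set of monomials belonging to $I$. Then ${\rm sv}(I)$ is the smallest integer $r$ for which there exist subsets $P_1,\dots,P_r$ of ${\rm Mon}(I)$ such that: (i) $|P_1|=1$; (ii) for all $\ell$ with $1<\ell\leq r$ and all $u,u''\in P_\ell$ with $u\neq u''$, there exist an integer $\ell'$ with $1\leq \ell'<\ell$ and an element $u'\in P_{\ell'}$ such that $uu''\in(u')$; (iii) $I$ is generated by $\bigcup_{i=1}^r P_i$. By convention ${\rm sv}(0)=0$. Stanley depth: let $M$ be a nonzero finitely generated $\mathbb{Z}^n$-graded $S$-module. For a homogeneous $u\in M$ and $Z\subseteq\{x_1,\dots,x_n\}$, the $\mathbb{K}$-subspace $u\mathbb{K}[Z]$ generated by all $uv$ with $v\in\mathbb{K}[Z]$ is called a Stanley space of dimension $|Z|$ if it is a free $\mathbb{K}[Z]$-module. A Stanley decomposition $\mathcal{D}$ of $M$ is a decomposition of $M$ as a finite direct sum of Stanley spaces; ${\rm sdepth}(\mathcal{D})$ is the minimum dimension of a Stanley space in $\mathcal{D}$, and ${\rm sdepth}(M)$ is the maximum of ${\rm sdepth}(\mathcal{D})$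 over all Stanley decompositions $\mathcal{D}$ of $M$. Stanley depth is defined only for nonzero modules, so the first inequality is asserted when $I\neq 0$ and the second when $I\neq S$. *)

(* Defs.v *)
From HB Require Import structures.
From mathcomp Require Import all_boot all_order all_algebra.
From mathcomp Require Import generic_quotient ring_quotient.
From mathcomp Require Import boolp.
From mathcomp Require Import mpoly.

Set Implicit Arguments.
Unset Strict Implicit.
Unset Printing Implicit Defensive.

Import GRing.Theory.
Local Open Scope ring_scope.
Local Open Scope quotient_scope.

(* The library's idealr is not used because it excludes the unit ideal.      *)
HB.mixin Record isMulAbsorbing (R : comNzRingType) (I : {pred R}) := {
  ideal_mull : forall a : R, {in I, forall u, a * u \in I}
}.

#[short(type="ideal")]
HB.structure Definition Ideal (R : comNzRingType) :=
  {I of GRing.ZmodClosed R I & isMulAbsorbing R I}.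

Section MonomialIdeals.
Variables (K : fieldType) (n : nat).
Local Notation S := {mpoly K[n]}.

Definition ideal_gen (A : S -> Prop) (f : S) : Prop :=
  exists2 s : seq (S * S),
    (forall t, t \in s -> A t.2) & f = \sum_(t <- s) t.1 * t.2.

(* Monomials are identified with their exponent vectors in 'X_{1..n}.         *)
Definition monomials (A : 'X_{1..n} -> Prop) (f : S) : Prop :=
  exists2 m, A m & f = 'X_[m].

Definition generated_by_monomials (I : ideal {mpoly K[n]})
  (A : 'X_{1..n} -> Prop) : Prop :=
  forall f : S, f \in I <-> ideal_gen (monomials A) f.

Definition squarefree (m : 'X_{1..n}) : Prop := forall i, (m i <= 1)%N.

Definition monomial_ideal (I : ideal {mpoly K[n]}) : Prop :=
  exists A, generated_by_monomials I A.

Definition squarefree_monomial_ideal (I : ideal {mpoly K[n]}) : Prop :=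
  exists2 A, (forall m, A m -> squarefree m) & generated_by_monomials I A.

Definition Mon (I : ideal {mpoly K[n]}) (m : 'X_{1..n}) : Prop := ('X_[m] : S) \in I.

Definition ideal_nonzero (I : ideal {mpoly K[n]}) : Prop :=
  exists2 f : S, f \in I & f != 0.

Definition ideal_proper (I : ideal {mpoly K[n]}) : Prop :=
  exists f : S, f \notin I.

(* Only the values P 1, ..., P r matter.                                      *)
Definition schmitt_vogel (I : ideal {mpoly K[n]}) (r : nat)
    (P : nat -> 'X_{1..n} -> Prop) : Prop :=
  [/\ forall l m, (1 <= l <= r)%N -> P l m -> Mon I m,
      exists! m, P 1%N m,
      forall l u u'', (1 < l <= r)%N -> P l u -> P l u'' -> u <> u'' ->
        exists l' u', [/\ (1 <= l' < l)%N, P l' u' &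
          ideal_gen (monomials (eq u')) ('X_[u] * 'X_[u''])]
    & generated_by_monomials I
        (fun m => exists2 l, (1 <= l <= r)%N & P l m)].

(* The junk value 0 of the last branch does not arise for monomial ideals.    *)
Definition sv (I : ideal {mpoly K[n]}) : nat :=
  if `[< ideal_nonzero I >] then
    if pselect (exists r, (0 < r)%N && `[< exists P, schmitt_vogel I r P >])
      is left ex_r then ex_minn ex_r else 0%N
  else 0%N.

End MonomialIdeals.

Section StanleyDepth.
Variables (K : fieldType) (n : nat).
Local Notation S := {mpoly K[n]}.
Local Notation Zn := {ffun 'I_n -> int}.

Definition poly_part (a : Zn) (f : S) : Prop :=
  forall m, m \in msupp f -> forall i, (m i)%:Z = a i.

(* S-modules are K-spaces through the constants c%:MP.                        *)
Definition Zn_grading (M : lmodType S) (part : Zn -> M -> Prop) : Prop :=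
  [/\ forall a, part a 0 /\
        (forall (c : K) x y, part a x -> part a y -> part a (c%:MP *: x + y)),
      forall a b p x, poly_part a p -> part b x -> part (a + b) (p *: x),
      forall x, exists (s : seq Zn) (y : Zn -> M),
        [/\ uniq s, forall a, part a (y a) & x = \sum_(a <- s) y a]
    & forall (s : seq Zn) (y : Zn -> M), uniq s -> (forall a, part a (y a)) ->
        \sum_(a <- s) y a = 0 -> forall a, a \in s -> y a = 0].

Definition subring_vars (Z : {set 'I_n}) : pred S :=
  [pred p : S |
    all (fun m : 'X_{1..n} => [forall i, (m i != 0%N) ==> (i \in Z)]) (msupp p)].

Section Module.
Variables (M : lmodType S) (part : Zn -> M -> Prop).

Definition homogeneous (u : M) : Prop := exists a, part a u.

Definition cyclic_space (u : M) (Z : {set 'I_n}) (x : M) : Prop :=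
  exists2 v, v \in subring_vars Z & x = v *: u.

(* Freeness of u K[Z] means that the generator u is a basis over K[Z]; in     *)
(* particular u is nonzero.                                                   *)
Definition stanley_space (u : M) (Z : {set 'I_n}) : Prop :=
  homogeneous u /\ {in subring_vars Z &, injective (fun v : S => v *: u)}.

Definition stanley_decomposition (D : seq (M * {set 'I_n})) : Prop :=
  (forall t, t \in D -> stanley_space t.1 t.2) /\
  (forall x : M, exists! y : {ffun 'I_(size D) -> M},
     (forall i, cyclic_space (tnth (in_tuple D) i).1
                             (tnth (in_tuple D) i).2 (y i)) /\
     x = \sum_i y i).

(* Every dimension is at most n, so this is a true minimum when D is not      *)
(* empty, as is the case for every decomposition of a nonzero module.         *)
Definition sdepth_decomposition (D : seq (M * {set 'I_n})) : nat :=
  \big[minn/n]_(t <- D) #|t.2|.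

(* sdepth makes sense for any family part of subsets of M; the lemmas         *)
(* ideal_grading and quot_grading show that the two families to which it is   *)
(* applied are Z^n-gradings.                                                  *)
Definition sdepth : nat :=
  \max_(d < n.+1 |
    `[< exists2 D, stanley_decomposition D & sdepth_decomposition D = d >]) d.

End Module.
End StanleyDepth.

Section IdealModule.
Variables (K : fieldType) (n : nat) (I : ideal {mpoly K[n]}).
Local Notation S := {mpoly K[n]}.

Record ideal_module := IdealModule { ideal_val :> S^o; _ : ideal_val \in I }.

HB.instance Definition _ := [isSub for ideal_val].
HB.instance Definition _ := [Choice of ideal_module by <:].

Fact ideal_submod : subsemimod_closed (fun f : S^o => f \in I).
Proof. by split; [split; [exact: rpred0 | exact: rpredD] | exact: ideal_mull]. Qed.

HB.instance Definition _ :=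
  GRing.SubChoice_isSubLmodule.Build S S^o _ ideal_module ideal_submod.

Definition ideal_part (a : {ffun 'I_n -> int}) (x : ideal_module) : Prop :=
  poly_part a (ideal_val x).

End IdealModule.

Arguments ideal_part {K n} I a x.

Section QuotientModule.
Variables (K : fieldType) (n : nat) (I : ideal {mpoly K[n]}).
Local Notation S := {mpoly K[n]}.

Definition quot_module : Type := Quotient.quot I.
HB.instance Definition _ := GRing.Zmodule.on quot_module.

Definition quot_pi (f : S) : quot_module := \pi_(Quotient.quot I) f.

Definition quot_scale (p : S) (x : quot_module) : quot_module :=
  quot_pi (p * repr (x : Quotient.quot I)).

Lemma quot_pi_surj (x : quot_module) : exists f, x = quot_pi f.
Proof. by exists (repr (x : Quotient.quot I)); rewrite /quot_pi reprK. Qed.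

Lemma quot_pi_eq (f g : S) : quot_pi f = quot_pi g <-> f - g \in I.
Proof. by rewrite Quotient.idealrBE /quot_pi; split=> [/eqP|/eqP]. Qed.

Lemma quot_piB : zmod_morphism quot_pi.
Proof. by move=> f g; rewrite /quot_pi raddfB. Qed.

HB.instance Definition _ :=
  GRing.isZmodMorphism.Build S quot_module quot_pi quot_piB.

Lemma quot_scale_pi p f : quot_scale p (quot_pi f) = quot_pi (p * f).
Proof.
apply/quot_pi_eq; rewrite -mulrBr ideal_mull //.
by apply/quot_pi_eq; rewrite /quot_pi reprK.
Qed.

Fact quot_scaleA a b x : quot_scale a (quot_scale b x) = quot_scale (a * b) x.
Proof. by have [f ->] := quot_pi_surj x; rewrite !quot_scale_pi mulrA. Qed.

Fact quot_scale1 : left_id 1 quot_scale.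
Proof. by move=> x; have [f ->] := quot_pi_surj x; rewrite quot_scale_pi mul1r. Qed.

Fact quot_scaleDr : right_distributive quot_scale +%R.
Proof.
move=> a x y; have [f ->] := quot_pi_surj x; have [g ->] := quot_pi_surj y.
by rewrite -raddfD !quot_scale_pi mulrDr raddfD.
Qed.

Fact quot_scaleDl x : {morph quot_scale^~ x : a b / a + b}.
Proof.
by move=> a b; have [f ->] := quot_pi_surj x; rewrite !quot_scale_pi mulrDl raddfD.
Qed.

HB.instance Definition _ := GRing.Zmodule_isLmodule.Build S quot_module
  quot_scaleA quot_scale1 quot_scaleDr quot_scaleDl.

Lemma quot_piZ p f : quot_pi (p * f) = p *: quot_pi f.
Proof. by rewrite -quot_scale_pi. Qed.

Definition quot_part (a : {ffun 'I_n -> int}) (x : quot_module) : Prop :=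
  exists2 f : S, poly_part a f & x = quot_pi f.

End QuotientModule.

Arguments quot_part {K n} I a x.

Section Gradings.
Variables (K : fieldType) (n : nat).
Local Notation S := {mpoly K[n]}.
Local Notation Zn := {ffun 'I_n -> int}.

Definition mdegree (m : 'X_{1..n}) : Zn := [ffun i => (m i)%:Z].

Lemma mdegree_inj : injective mdegree.
Proof.
move=> m m' /ffunP eqm; apply/mnmP => i.
by move: (eqm i); rewrite !ffunE => -[].
Qed.

Lemma poly_partE (a : Zn) (f : S) :
  poly_part a f <-> {in msupp f, forall m, mdegree m = a}.
Proof.
split=> h m mf; first by apply/ffunP => i; rewrite ffunE h.
by move=> i; rewrite -(h m mf) ffunE.
Qed.

Lemma poly_part_coef (a : Zn) (f : S) m :
  poly_part a f -> mdegree m != a -> f@_m = 0.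
Proof.
move=> /poly_partE h nm; apply/eqP; rewrite mcoeff_eq0.
by apply: contra nm => /h ->.
Qed.

Lemma poly_part0 (a : Zn) : poly_part a (0 : S).
Proof. by move=> m; rewrite mcoeff_msupp mcoeff0 eqxx. Qed.

Lemma poly_partD (a : Zn) (f g : S) :
  poly_part a f -> poly_part a g -> poly_part a (f + g).
Proof.
move=> hf hg m /msuppD_le; rewrite mem_cat => /orP[]; [exact: hf | exact: hg].
Qed.

Lemma poly_partM (a b : Zn) (f g : S) :
  poly_part a f -> poly_part b g -> poly_part (a + b) (f * g).
Proof.
move=> hf hg m /msuppM_le /allpairsP[[m1 m2] /= [h1 h2 ->]] i.
by rewrite mnmDE ffunE PoszD (hf _ h1) (hg _ h2).
Qed.

Lemma poly_partC (c : K) : poly_part 0 (c%:MP : S).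
Proof.
move=> m; rewrite msuppC; case: ifP => // _; rewrite inE => /eqP -> i.
by rewrite mnm0E ffunE.
Qed.

Lemma poly_partX (m : 'X_{1..n}) (c : K) :
  poly_part (mdegree m) (c *: 'X_[m] : S).
Proof.
by move=> m' /msuppZ_le; rewrite msuppX inE => /eqP -> i; rewrite ffunE.
Qed.

Definition poly_comp (f : S) (a : Zn) : S :=
  \sum_(m <- msupp f | mdegree m == a) f@_m *: 'X_[m].

Lemma poly_comp_part f a : poly_part a (poly_comp f a).
Proof.
rewrite /poly_comp; elim/big_rec: _ => [|m p /eqP <- hp]; first exact: poly_part0.
by apply: poly_partD => //; apply: poly_partX.
Qed.

Definition degrees (f : S) : seq Zn := map mdegree (msupp f).

Lemma degrees_uniq f : uniq (degrees f).
Proof. by rewrite map_inj_uniq ?msupp_uniq //; exact: mdegree_inj. Qed.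

Lemma poly_comp_sum f : f = \sum_(a <- degrees f) poly_comp f a.
Proof.
rewrite /degrees big_map {1}[f]mpolyE; apply: eq_big_seq => m mf.
rewrite /poly_comp (big_rem m) //= eqxx.
rewrite big_seq_cond big1 ?addr0 // => m' /andP[].
rewrite mem_rem_uniq ?msupp_uniq // inE => /andP[/negP nm _] /eqP e.
by case: nm; apply/eqP/mdegree_inj.
Qed.

Lemma poly_sum_coef (s : seq Zn) (y : Zn -> S) a m :
  uniq s -> (forall a, poly_part a (y a)) -> a \in s -> m \in msupp (y a) ->
  (\sum_(b <- s) y b)@_m = (y a)@_m.
Proof.
move=> us hy sa my; rewrite (raddf_sum (mcoeff m)) (big_rem a) //=.
rewrite big_seq big1 ?addr0 // => b; rewrite mem_rem_uniq // inE => /andP[nba _].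
apply: (poly_part_coef (hy b)).
by have /poly_partE -> // := hy a; rewrite eq_sym.
Qed.

Variable I : ideal {mpoly K[n]}.
Hypothesis monI : monomial_ideal I.

Lemma monomial_ideal_msupp (f : S) m :
  f \in I -> m \in msupp f -> ('X_[m] : S) \in I.
Proof.
have [A genA] := monI.
move=> /genA[s hs ->] mf.
have [t ts mt] : exists2 t, t \in s & m \in msupp (t.1 * t.2).
  have := msupp_sum_le mf; rewrite filter_predT.
  by move=> /flatten_mapP[t ts mt]; exists t.
have [u Au e] := hs t ts.
move: mt; rewrite e => /msuppM_le /allpairsP[[m1 m2] /= [_]].
rewrite msuppX inE => /eqP -> ->; rewrite mpolyXD; apply: ideal_mull.
apply/genA; exists [:: (1, 'X_[u])]; last by rewrite big_seq1 mul1r.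
by move=> t'; rewrite inE => /eqP -> /=; exists u.
Qed.

Lemma monomial_ideal_comp (f : S) a : f \in I -> poly_comp f a \in I.
Proof.
move=> fI; rewrite /poly_comp big_seq_cond.
apply: rpred_sum => m /andP[mf _].
by rewrite -mul_mpolyC; apply: ideal_mull; apply: monomial_ideal_msupp mf.
Qed.

Lemma ideal_grading : Zn_grading (ideal_part I).
Proof.
split.
- move=> a; split=> [|c x y]; first exact: poly_part0.
  rewrite /ideal_part => hx hy; apply: poly_partD => //=.
  by rewrite -[a]add0r; apply: poly_partM => //; apply: poly_partC.
- by move=> a b p x hp hx; apply: poly_partM.
- move=> x.
  have hI a : poly_comp (ideal_val x) a \in I.
    by apply: monomial_ideal_comp; apply: valP.
  exists (degrees (ideal_val x)), (fun a => IdealModule (hI a)).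
  split; [exact: degrees_uniq | by move=> a; exact: poly_comp_part |].
  by apply: val_inj; rewrite raddf_sum /=; exact: poly_comp_sum.
- move=> s y us hy /(congr1 val); rewrite raddf_sum /= => y0 a sa.
  apply: val_inj; apply/eqP; rewrite /= -msupp_eq0.
  case E: (msupp _) => [//|m l].
  have my : m \in msupp (val (y a)) by rewrite E mem_head.
  have := poly_sum_coef us hy sa my.
  rewrite y0 mcoeff0 => /esym/eqP; rewrite mcoeff_eq0.
  by move=> /negP[].
Qed.

Lemma quot_grading : Zn_grading (quot_part I).
Proof.
split.
- move=> a; split=> [|c x y [f hf ->] [g hg ->]].
    by exists 0; [exact: poly_part0 | rewrite raddf0].
  exists (c%:MP * f + g); last by rewrite raddfD -quot_piZ.
  apply: poly_partD => //.
  by rewrite -[a]add0r; apply: poly_partM => //; apply: poly_partC.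
- move=> a b p x hp [f hf ->]; exists (p * f); last by rewrite -quot_piZ.
  exact: poly_partM.
- move=> x; have [f ->] := quot_pi_surj x.
  exists (degrees f), (fun a => quot_pi I (poly_comp f a)).
  split; first exact: degrees_uniq.
    by move=> a; exists (poly_comp f a) => //; exact: poly_comp_part.
  by rewrite {1}[f]poly_comp_sum raddf_sum.
- move=> s y us hy y0 a sa.
  have /choice[F hF] : forall b, exists f : S, poly_part b f /\ y b = quot_pi I f.
    by move=> b; have [f ? ?] := hy b; exists f.
  have : quot_pi I (\sum_(b <- s) F b) = quot_pi I 0.
    by rewrite raddf0 raddf_sum -[RHS]y0; apply: eq_bigr => b _; case: (hF b).
  move=> /quot_pi_eq; rewrite subr0 => sI.
  case: (hF a) => _ ->; rewrite -(raddf0 (quot_pi I)).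
  apply/quot_pi_eq; rewrite subr0 [F a]mpolyE big_seq.
  apply: rpred_sum => m mF.
  rewrite -mul_mpolyC; apply: ideal_mull; apply: monomial_ideal_msupp sI _.
  by rewrite mcoeff_msupp (poly_sum_coef us (fun b => (hF b).1) sa mF) -mcoeff_msupp.
Qed.

End Gradings.

(* Main.v *)
Require Import Defs.
From mathcomp Require Import all_boot all_order all_algebra.
From mathcomp Require Import mpoly.
From mathcomp Require Import boolp zify.

Set Implicit Arguments.
Unset Strict Implicit.
Unset Printing Implicit Defensive.

(* Replacing monomials by their supports turns a Schmitt-Vogel system of a    *)
(* squarefree ideal into levels of subsets of {0, ..., n-1}, and a partition  *)
(* of a family of subsets into intervals [A, B] turns into a Stanley          *)
(* decomposition with spaces x_A K[B].  Let r be the number of levels.  The   *)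
(* supports outside I are partitioned by induction on r: if x divides the     *)
(* only monomial of the first level, then I + (x) has r - 1 levels in one     *)
(* variable less, and I : x has r levels but a smaller first monomial.  For   *)
(* the supports in I, write J_l for the ideal generated by the first l        *)
(* levels; J_l / J_(l-1) is the direct sum, over the monomials u of level l,  *)
(* of u S / (u S :&: J_(l-1)), to which the first part applies.               *)

(** Membership of a monomial in a squarefree ideal depends only on its support, and an interval
    [A, B] gives a Stanley space of dimension |B|, so only the upper ends must be kept large. In
    [uncovered_partition] each level costs at most one variable of an upper end, whence n - r for
    S/I. In [covered_partition] the supports first covered by level l have only l - 1 levels to
    avoid, so their upper ends have at least n - (l - 1) >= n - r + 1 elements: this is the extra 1
    for I. [interval_stanley_decomposition] transfers both partitions to modules, and [sv_spec]
    supplies r = sv(I). *)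

Section IntervalPartitions.
Variable T : finType.
Implicit Types (A V X u : {set T}) (P : {set {set T}}) (Ps : seq {set {set T}}).
Implicit Types (t : {set T} * {set T}) (D : seq ({set T} * {set T})).

Definition in_interval X t := (t.1 \subset X) && (X \subset t.2).

(** A count equal to [F X] encodes disjointness and exact covering at once. *)
Definition interval_partition (F : pred {set T}) (d : nat) D :=
  [/\ forall X, count (in_interval X) D = F X,
      forall t, t \in D -> t.1 \subset t.2
    & forall t, t \in D -> d <= #|t.2|].

Definition covered Ps X := has (fun P => [exists u in P, u \subset X]) Ps.

(** Levels are numbered from 0. At [i = 0] no [j] exists, so the first level has at most one set
    inside [V]; this form of |P_1| = 1 survives shrinking [V], which may leave no such set. *)
Definition sv_levels V Ps := forall i u u'',
  i < size Ps -> u \in nth set0 Ps i -> u'' \in nth set0 Ps i ->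
  u \subset V -> u'' \subset V -> u <> u'' ->
  exists j u', [/\ j < i, u' \in nth set0 Ps j & u' \subset u :|: u''].

Lemma coveredP Ps X :
  reflect (exists i u, [/\ i < size Ps, u \in nth set0 Ps i & u \subset X])
          (covered Ps X).
Proof.
apply: (iffP (has_nthP set0)) => [[i si /existsP[u /andP[uP uX]]]|[i [u [si uP uX]]]].
  by exists i, u.
by exists i => //; apply/existsP; exists u; rewrite uP.
Qed.

Lemma covered_rcons Ps P X :
  covered (rcons Ps P) X = covered Ps X || [exists u in P, u \subset X].
Proof. by rewrite /covered has_rcons orbC. Qed.

Lemma interval_partition0 (F : pred {set T}) d :
  F =1 xpred0 -> interval_partition F d [::].
Proof. by move=> F0; split=> // X; rewrite F0. Qed.

Lemma interval_partitionW (F : pred {set T}) d d' D :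
  d' <= d -> interval_partition F d D -> interval_partition F d' D.
Proof. by move=> le_d [? ? Dd]; split=> // t /Dd; exact: leq_trans. Qed.

Lemma interval_partition_cat (F F1 F2 : pred {set T}) d D1 D2 :
  (forall X, (F1 X + F2 X)%N = F X) ->
  interval_partition F1 d D1 -> interval_partition F2 d D2 ->
  interval_partition F d (D1 ++ D2).
Proof.
move=> FE [c1 s1 d1] [c2 s2 d2]; split=> [X|t|t].
- by rewrite count_cat c1 c2 FE.
- by rewrite mem_cat => /orP[/s1|/s2].
- by rewrite mem_cat => /orP[/d1|/d2].
Qed.

Lemma sv_levels_sub V V' Ps : V' \subset V -> sv_levels V Ps -> sv_levels V' Ps.
Proof.
move=> sV h i u u'' si uP uP'' uV uV''.
by apply: h => //; [exact: subset_trans sV | exact: subset_trans sV].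
Qed.

(** A witness [u'] in the dropped level would lie in [u :|: u''], hence in [V]. *)
Lemma sv_levels_behead V P Ps :
  (forall u, u \in P -> ~~ (u \subset V)) -> sv_levels V (P :: Ps) ->
  sv_levels V Ps.
Proof.
move=> PV h i u u'' si uP uP'' uV uV'' nu.
have [[|j] [u' [ji uj us]]] := h i.+1 u u'' si uP uP'' uV uV'' nu; last by exists j, u'.
by have := PV _ uj; rewrite (subset_trans us) // subUset uV.
Qed.

Lemma sv_levels_rcons V P Ps : sv_levels V (rcons Ps P) -> sv_levels V Ps.
Proof.
move=> h i u u'' si uP uP'' uV uV'' nu.
have si' : i < size (rcons Ps P) by rewrite size_rcons ltnW.
have [] := h i u u'' si' _ _ uV uV'' nu; rewrite ?nth_rcons ?si //.
move=> j [u' [ji uj us]]; exists j, u'; split=> //.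
by move: uj; rewrite nth_rcons (ltn_trans ji si).
Qed.

(* Splitting off a variable x of the unique minimal set u of the first level: *)
(* the sets avoiding x lose that whole level together with one variable,      *)
(* while for the sets containing x the set u has become smaller.              *)
Lemma uncovered_partition Ps V A :
  A \subset V -> sv_levels V Ps ->
  exists D, interval_partition
    (fun X => [&& A \subset X, X \subset V & ~~ covered Ps X])
    (#|V| - size Ps) D.
Proof.
elim: Ps V A => [|P Ps IH] V A AV svP.
  exists [:: (A, V)]; split=> [X|t|t].
  - by rewrite /= addn0 andbT.
  - by rewrite inE => /eqP->.
  - by rewrite inE => /eqP->; rewrite subn0.
have [/existsP[u /andP[uP uV]]|noP] := boolP [exists u in P, u \subset V]; last first.
  have PV u : u \in P -> ~~ (u \subset V).
    by move=> uP; apply: contra noP => uV; apply/existsP; exists u; rewrite uP.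
  have [D [cD sD dD]] := IH V A AV (sv_levels_behead PV svP).
  exists D; apply: (@interval_partitionW _ (#|V| - size Ps)); first by rewrite /=; lia.
  split=> // X; rewrite cD; congr (nat_of_bool _); apply: andb_id2l => _.
  apply: andb_id2l => XV; congr (~~ _); rewrite /=.
  rewrite [X in X || _](_ : _ = false) //; apply/negbTE; apply: contra noP.
  move=> /existsP[u /andP[uP uX]]; apply/existsP; exists u.
  by rewrite uP (subset_trans uX).
have [k] := ubnP #|u :\: A|; elim: k A AV => // k IHk A AV; rewrite ltnS => lek.
have [uA|/subsetPn[x xu xA]] := boolP (u \subset A).
  exists [::]; apply: interval_partition0 => X.
  apply/negbTE/negP => /and3P[AX _ /negP[]]; apply/coveredP; exists 0%N, u.
  by split=> //; exact: subset_trans AX.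
have xV : x \in V by exact: (subsetP uV).
(* One variable and one level are lost together, so the bound is unchanged. *)
have [||D1 P1] := IH (V :\ x) A.
- by rewrite subsetD1 AV.
- apply: (@sv_levels_behead _ P); last exact: sv_levels_sub (subsetDl _ _) svP.
  move=> w wP; rewrite subsetD1; apply/negP => /andP[wV xw].
  have uw : u <> w by move=> e; rewrite -e xu in xw.
  by have [j [u' []]] := svP 0%N u w isT uP wP uV wV uw.
have [||D2 P2] := IHk (x |: A).
- by rewrite subUset sub1set xV.
- apply: leq_trans lek; apply: proper_card; apply/properP.
  split; first exact/setDS/subsetUr.
  by exists x; rewrite !inE ?eqxx // xA.
exists (D1 ++ D2); apply: interval_partition_cat P2; last first.
  apply: interval_partitionW P1; rewrite (cardsD1 x V) xV /=; lia.
move=> X; rewrite subUset sub1set subsetD1.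
have [xX|xX] := boolP (x \in X); first by rewrite !andbF.
rewrite /= andbT addn0; congr (nat_of_bool _); apply: andb_id2l => _.
apply: andb_id2l => XV; congr (~~ _).
rewrite [RHS]/= [X in _ = X || _](_ : _ = false) //.
apply/negbTE/negP => /existsP[w /andP[wP wX]].
have uw : u <> w by move=> e; move: xX; rewrite (subsetP wX) // -e.
by have [j [u' []]] := svP 0%N u w isT uP wP uV (subset_trans wX XV) uw.
Qed.

(* Two sets u <> u'' of the same level lie in no common X that is uncovered   *)
(* by the previous levels, so the sets newly covered by a level split         *)
(* according to the unique u of that level that they contain.                 *)
Lemma covered_partition Ps :
  sv_levels setT Ps ->
  exists D, interval_partition (covered Ps) (#|T|.+1 - size Ps) D.
Proof.
elim/last_ind: Ps => [|Ps P IH] svP; first by exists [::]; exact: interval_partition0.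
have svPs := sv_levels_rcons svP; have [D0 P0] := IH svPs.
suff [D1 P1] : exists D, interval_partition
    (fun X => ~~ covered Ps X && [exists u in P, u \subset X]) (#|T| - size Ps) D.
  exists (D0 ++ D1); rewrite size_rcons subSS.
  apply: interval_partition_cat P1; last by apply: interval_partitionW P0; lia.
  by move=> X; rewrite covered_rcons; case: covered.
suff [D1 P1] : exists D, interval_partition
    (fun X => ~~ covered Ps X && has (fun u => u \subset X) (enum P))
    (#|T| - size Ps) D.
  exists D1; case: P1 => c1 s1 d1; split=> // X; rewrite c1.
  congr (nat_of_bool (_ && _)); apply/hasP/existsP => [[u]|[u /andP[uP uX]]].
    by rewrite mem_enum => uP uX; exists u; rewrite uP.
  by exists u; rewrite ?mem_enum.
(* Each [u] of the last level contributes a partition of the sets above [u] uncovered by [Ps]; these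
   are glued one [u] at a time. *)
have : {subset enum P <= P} by move=> u; rewrite mem_enum.
elim: (enum P) (enum_uniq P) => [|u s IHs] /=.
  by exists [::]; apply: interval_partition0 => X; rewrite andbF.
move=> /andP[us /IHs{}IHs] usP.
have [|D1 P1] := IHs; first by move=> w ws; apply: usP; rewrite inE ws orbT.
have [D2 P2] := uncovered_partition (subsetT u) svPs.
exists (D2 ++ D1); apply: interval_partition_cat P1; last first.
  by rewrite -cardsT; exact: P2.
move=> X /=; rewrite subsetT /=.
have [uX|] := boolP (u \subset X); last by [].
have [//|ncX] := boolP (covered Ps X) => /=.
rewrite [has _ _](_ : _ = false) ?addn0 //; apply/negbTE/negP => /hasP[w ws wX].
have uw : u <> w by move=> e; rewrite e ws in us.
have [|||j [u' [ji]]] := svP (size Ps) u w _ _ _ (subsetT _) (subsetT _) uw.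
- by rewrite size_rcons.
- by rewrite nth_rcons ltnn eqxx usP ?mem_head.
- by rewrite nth_rcons ltnn eqxx usP // inE ws orbT.
rewrite nth_rcons ji => u'P u'uw; move/negP: ncX; apply; apply/coveredP.
by exists j, u'; split=> //; rewrite (subset_trans u'uw) // subUset uX.
Qed.

End IntervalPartitions.

Import GRing.Theory.
Local Open Scope ring_scope.

(** * Exponent vectors and their supports *)

Section Supports.
Variable n : nat.
Implicit Types (m : 'X_{1..n}) (A X : {set 'I_n}).

Definition mnm_supp m : {set 'I_n} := [set i | m i != 0%N].

Definition mnm_ind A : 'X_{1..n} := [multinom (i \in A : nat) | i < n].

Lemma mnm_supp_ind A : mnm_supp (mnm_ind A) = A.
Proof. by apply/setP => i; rewrite inE mnmE eqb0 negbK. Qed.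

Lemma mnm_suppD m m' : mnm_supp (m + m')%MM = mnm_supp m :|: mnm_supp m'.
Proof. by apply/setP => i; rewrite !inE mnmDE addn_eq0 negb_and. Qed.

Lemma mnm_supp_le m m' : (m <= m')%MM -> mnm_supp m \subset mnm_supp m'.
Proof. by move=> /submK <-; rewrite mnm_suppD subsetUr. Qed.

Lemma squarefree_ind A : squarefree (mnm_ind A).
Proof. by move=> i; rewrite mnmE leq_b1. Qed.

Lemma squarefree_le m m' :
  squarefree m -> mnm_supp m \subset mnm_supp m' -> (m <= m')%MM.
Proof.
move=> sfm /subsetP mm'; apply/mnm_lepP => i; have := sfm i; have := mm' i.
rewrite !inE; lia.
Qed.

Lemma squarefree_ind_supp m : squarefree m -> mnm_ind (mnm_supp m) = m.
Proof.
by move=> sfm; apply/mnmP => i; have := sfm i; rewrite mnmE inE; case: (m i) => [|[]].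
Qed.

Lemma mnm_ind_le A m : (mnm_ind A <= m)%MM = (A \subset mnm_supp m).
Proof.
apply/idP/idP => [/mnm_supp_le|Am]; first by rewrite mnm_supp_ind.
by apply: squarefree_le (@squarefree_ind A) _; rewrite mnm_supp_ind.
Qed.

End Supports.

(** * Polynomials with prescribed supports *)

Section Restriction.
Variables (K : fieldType) (n : nat).
Local Notation S := {mpoly K[n]}.
Implicit Types (f v : S) (m : 'X_{1..n}) (A Z : {set 'I_n}).

Definition mpoly_restrict (F : pred 'X_{1..n}) f : S :=
  \sum_(m <- msupp f | F m) f@_m *: 'X_[m].

Lemma mcoeff_restrict F f m :
  (mpoly_restrict F f)@_m = if F m then f@_m else 0.
Proof.
rewrite /mpoly_restrict raddf_sum /=.
rewrite (eq_bigr (fun k => if k == m then f@_m else 0)); last first.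
  by move=> k _; rewrite mcoeffZ mcoeffX; case: eqP => [->|_]; rewrite ?mulr1 ?mulr0.
rewrite -big_mkcondr /=.
have [mf|mf] := boolP (m \in msupp f).
  rewrite (big_rem m) //= eqxx andbT big_seq_cond big1 ?addr0 // => k /andP[].
  by rewrite mem_rem_uniq ?msupp_uniq // inE => /andP[/negPf ->]; rewrite andbF.
by rewrite (memN_msupp_eq0 mf) big1 ?if_same.
Qed.

Lemma mpoly_restrict_id (F : pred 'X_{1..n}) f :
  {in msupp f, forall m, F m} -> mpoly_restrict F f = f.
Proof.
move=> Ff; apply/mpolyP => m; rewrite mcoeff_restrict; case: ifP => // Fm.
by rewrite memN_msupp_eq0 //; apply: contraFN Fm => /Ff.
Qed.

Lemma mpoly_restrictB F f g :
  mpoly_restrict F (f - g) = mpoly_restrict F f - mpoly_restrict F g.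
Proof.
apply/mpolyP => m; rewrite mcoeffB !mcoeff_restrict mcoeffB.
by case: ifP => // _; rewrite subr0.
Qed.

Lemma subring_varsP Z v :
  reflect {in msupp v, forall m, mnm_supp m \subset Z} (v \in subring_vars Z).
Proof.
apply: (iffP allP) => h m /h.
  by move=> /forallP mZ; apply/subsetP => i; rewrite inE => mi; exact: (implyP (mZ i)).
by move=> /subsetP mZ; apply/forallP => i; apply/implyP => mi; apply: mZ; rewrite inE.
Qed.

Lemma msupp_interval A Z v m :
  A \subset Z -> v \in subring_vars Z -> m \in msupp (v * 'X_[mnm_ind A]) ->
  in_interval (mnm_supp m) (A, Z).
Proof.
move=> AZ /subring_varsP vZ; rewrite (perm_mem (msuppMX _ _)) => /mapP[k kv ->].
by rewrite /in_interval mnm_suppD mnm_supp_ind /= subsetUl subUset AZ vZ.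
Qed.

(** With [msupp_interval], this identifies x_A K[Z] as the span of the monomials with support in
    [A, Z]. *)
Lemma interval_factor A Z f :
  {in msupp f, forall m, in_interval (mnm_supp m) (A, Z)} ->
  exists2 v, v \in subring_vars Z & f = v * 'X_[mnm_ind A].
Proof.
move=> fAZ; exists (\sum_(m <- msupp f) f@_m *: 'X_[m - mnm_ind A]).
  apply/subring_varsP; rewrite big_seq.
  elim/big_rec: _ => [m|m p mf IHp k]; first by rewrite msupp0.
  move=> /msuppD_le; rewrite mem_cat => /orP[/msuppZ_le|/IHp//].
  rewrite msuppX inE => /eqP->; have /andP[_] := fAZ m mf.
  by apply: subset_trans; apply: mnm_supp_le; exact: lem_subr.
rewrite {1}[f]mpolyE mulr_suml; apply: eq_big_seq => m mf.
by rewrite -scalerAl -mpolyXD submK // mnm_ind_le; have /andP[] := fAZ m mf.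
Qed.

End Restriction.

(** * From interval partitions to Stanley decompositions *)

Section StanleyFromIntervals.
Variables (K : fieldType) (n : nat).
Local Notation S := {mpoly K[n]}.
Variables (M : lmodType S) (part : {ffun 'I_n -> int} -> M -> Prop).

(** The bound [d <= n] covers an empty [D], whose minimum is the default [n]. *)
Lemma le_sdepth d (D : seq (M * {set 'I_n})) :
  stanley_decomposition part D -> (d <= n)%N ->
  (forall t, t \in D -> (d <= #|t.2|)%N) -> (d <= sdepth part)%N.
Proof.
move=> decD dn dD; set e := sdepth_decomposition D.
have de : (d <= e)%N.
  rewrite /e /sdepth_decomposition big_seq; elim/big_rec: _ => // t k tD dk.
  by rewrite leq_min dD.
have en : (e < n.+1)%N.
  rewrite ltnS /e /sdepth_decomposition; elim/big_rec: _ => // t k _ kn.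
  by rewrite geq_min kn orbT.
rewrite (leq_trans de) // /sdepth.
have := @leq_bigmax_cond _ (fun d : 'I_n.+1 => `[< exists2 D,
  stanley_decomposition part D & sdepth_decomposition D = d >]) (fun d => d)
  (Ordinal en).
by apply; apply/asboolP; exists D.
Qed.

(* nu sends an element of M to its expansion in the K-basis of M formed by    *)
(* the monomials whose support satisfies F; g A is the basis element with     *)
(* expansion 'X_[mnm_ind A].                                                  *)
Lemma interval_stanley_decomposition (F : pred {set 'I_n}) (nu : M -> S)
    (g : {set 'I_n} -> M) d D :
  interval_partition F d D ->
  {morph nu : x y / x + y} -> injective nu ->
  (forall x, {in msupp (nu x), forall m, F (mnm_supp m)}) ->
  (forall A, F A -> homogeneous part (g A)) ->
  (forall A v, F A ->
     {in msupp (v * 'X_[mnm_ind A]), forall m, F (mnm_supp m)} ->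
     nu (v *: g A) = v * 'X_[mnm_ind A]) ->
  stanley_decomposition part [seq (g t.1, t.2) | t <- D].
Proof.
move=> [cD sD dD] nuD nu_inj nuF homg nug.
have nu0 : nu 0 = 0 by apply: (addrI (nu 0)); rewrite -nuD !addr0.
have intF t X : t \in D -> in_interval X t -> F X.
  move=> tD tX; have := cD X; case: (F X) => // c0.
  by have := has_count (in_interval X) D; rewrite c0 => /hasPn/(_ t tD); rewrite tX.
have nugD t v : t \in D -> v \in subring_vars t.2 ->
    nu (v *: g t.1) = v * 'X_[mnm_ind t.1].
  move=> tD vt; apply: nug.
    by apply: (intF t) => //; rewrite /in_interval subxx sD.
  move=> m mv; apply: (intF t) => //; rewrite (surjective_pairing t).
  by apply: msupp_interval mv => //; exact: sD.
split=> [_ /mapP[t tD ->] /=|x].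
  split.
    by apply: homg; apply: (intF t) => //; rewrite /in_interval subxx sD.
  (* Under [nu] the action on the generator is multiplication by a nonzero monomial in a domain. *)
  move=> v w vt wt /(congr1 nu) /=; rewrite !nugD //; apply: mulIf.
  apply/eqP => /(congr1 (mcoeff (mnm_ind t.1))) /eqP.
  by rewrite mcoeffX mcoeff0 eqxx oner_eq0.
set D' := [seq _ | t <- D].
pose E (i : 'I_(size D')) := nth (set0, set0) D i.
have szE (i : 'I_(size D')) : (i < size D)%N by rewrite -(size_map (fun t => (g t.1, t.2))).
have ED i : E i \in D by rewrite mem_nth.
have tE i : tnth (in_tuple D') i = (g (E i).1, (E i).2).
  by rewrite (tnth_nth (g set0, set0)) /= (nth_map (set0, set0)).
have sumE X : (\sum_i in_interval X (E i))%N = F X.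
  rewrite -cD -sumn_count sumnE big_map (big_nth (set0, set0)) big_mkord /E.
  by rewrite -[size D](size_map (fun t => (g t.1, t.2))).
(* The component of [x] in the [i]-th space collects the terms with support in the [i]-th
   interval. *)
pose f i : S := mpoly_restrict (fun m => in_interval (mnm_supp m) (E i)) (nu x).
have /choice[v vP] : forall i, exists v,
    v \in subring_vars (E i).2 /\ f i = v * 'X_[mnm_ind (E i).1].
  move=> i; have [|v ? ?] := @interval_factor K n (E i).1 (E i).2 (f i).
    move=> m; rewrite mcoeff_msupp mcoeff_restrict -surjective_pairing.
    by case: ifP => // _; rewrite eqxx.
  by exists v.
have nuv i : nu (v i *: g (E i).1) = f i by case: (vP i) => vE ->; exact: nugD.
exists [ffun i => v i *: g (E i).1]; split=> [|y [yD xE]].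
  split=> [i|]; first by exists (v i); rewrite tE ?ffunE //; case: (vP i).
  apply: nu_inj; rewrite (big_morph nu nuD nu0); apply/mpolyP => m.
  rewrite raddf_sum /= (eq_bigr (fun i => (nu x)@_m *+ in_interval (mnm_supp m) (E i))).
    rewrite sumrMnr sumE; have [|mx] := boolP (m \in msupp (nu x)).
      by move=> /nuF ->.
    by rewrite (memN_msupp_eq0 mx) mul0rn.
  by move=> i _; rewrite ffunE nuv mcoeff_restrict mulrb.
apply/ffunP => i; rewrite ffunE; apply: nu_inj; rewrite nuv.
(* Uniqueness: the expansions of the [y j] live on disjoint intervals, so each coefficient of [nu x]
   comes from a single [y i]. *)
have ysupp j m : (nu (y j))@_m != 0 -> in_interval (mnm_supp m) (E j).
  have [w wE ->] := yD j; move: wE; rewrite tE /= => wE; rewrite nugD //.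
  rewrite -mcoeff_msupp => mw; rewrite (surjective_pairing (E j)).
  by apply: msupp_interval mw => //; exact: sD.
apply/mpolyP => m; rewrite mcoeff_restrict; case: ifP => mi; last first.
  by apply/esym/eqP; apply: contraFT mi; exact: ysupp.
rewrite xE (big_morph nu nuD nu0) raddf_sum (bigD1 i) //= big1 ?addr0 // => j ji.
apply/eqP; apply: contraT => /ysupp mj.
have := sumE (mnm_supp m); rewrite (bigD1 i) //= (bigD1 j) //= mi mj.
by case: (F _).
Qed.

End StanleyFromIntervals.

(** * Squarefree ideals, their Schmitt-Vogel levels and Stanley depth bounds *)

Section SquarefreeIdeal.
Variables (K : fieldType) (n : nat).
Local Notation S := {mpoly K[n]}.

Lemma ideal_gen_mpolyX (A : 'X_{1..n} -> Prop) m :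
  ideal_gen (monomials A) ('X_[m] : S) <-> exists2 a, A a & (a <= m)%MM.
Proof.
split=> [[s hs mE]|[a Aa am]]; last first.
  exists [:: ('X_[m - a], 'X_[a])] => [t|].
    by rewrite inE => /eqP-> /=; exists a.
  by rewrite big_seq1 -mpolyXD submK.
have : m \in msupp ('X_[m] : S) by rewrite msuppX mem_head.
rewrite mE => /msupp_sum_le; rewrite filter_predT => /flatten_mapP[t ts].
have [a Aa ->] := hs t ts; move=> /msuppM_le /allpairsP[[k1 k2] /= [_]].
rewrite msuppX inE => /eqP-> ->.
by exists a => //; exact: lem_addl.
Qed.

Variable I : ideal {mpoly K[n]}.

Definition in_support : pred {set 'I_n} := fun X => ('X_[mnm_ind X] : S) \in I.

Hypothesis sqfI : squarefree_monomial_ideal I.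

Lemma squarefree_monomial : monomial_ideal I.
Proof. by have [A _ genA] := sqfI; exists A. Qed.

Lemma mem_mpolyX_le m m' :
  (m <= m')%MM -> ('X_[m] : S) \in I -> ('X_[m'] : S) \in I.
Proof. by move=> /submK <- mI; rewrite mpolyXD; exact: ideal_mull. Qed.

(** Here squarefreeness enters: a squarefree generator dividing a monomial already divides the
    product of the variables in its support. *)
Lemma mem_mpolyX m : (('X_[m] : S) \in I) = in_support (mnm_supp m).
Proof.
apply/idP/idP => mI; last by apply: mem_mpolyX_le mI; rewrite mnm_ind_le.
have [A sqfA genA] := sqfI.
have /ideal_gen_mpolyX[a Aa am] := (genA _).1 mI.
apply/genA/ideal_gen_mpolyX; exists a => //; apply: squarefree_le; first exact: sqfA.
by rewrite mnm_supp_ind mnm_supp_le.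
Qed.

Lemma in_supportS (X Y : {set 'I_n}) : X \subset Y -> in_support X -> in_support Y.
Proof. by move=> XY; apply: mem_mpolyX_le; rewrite mnm_ind_le mnm_supp_ind. Qed.

Lemma mem_ideal_msupp (f : S) :
  {in msupp f, forall m, in_support (mnm_supp m)} -> f \in I.
Proof.
move=> fI; rewrite [f]mpolyE big_seq; apply: rpred_sum => m mf.
by rewrite -mul_mpolyC; apply: ideal_mull; rewrite mem_mpolyX fI.
Qed.

Lemma msupp_in_support (f : S) :
  f \in I -> {in msupp f, forall m, in_support (mnm_supp m)}.
Proof.
move=> fI m mf; rewrite -mem_mpolyX.
exact: monomial_ideal_msupp squarefree_monomial _ _ fI mf.
Qed.

(** The monomials of [P] need not be squarefree, but distinct supports come from distinct monomials,
    so the lcm condition passes to supports. Level [l] moves to index [l - 1]. *)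
Lemma schmitt_vogel_levels r P : schmitt_vogel I r P ->
  exists Ps, [/\ size Ps = r, sv_levels setT Ps & covered Ps =1 in_support].
Proof.
move=> [_ P1 P2 genP].
pose Q l := [set X | `[< exists2 m, P l m & mnm_supp m = X >]].
have QP l X : reflect (exists2 m, P l m & mnm_supp m = X) (X \in Q l).
  by rewrite inE; exact: asboolP.
have nthQ i : (i < r)%N -> nth set0 [seq Q l | l <- iota 1 r] i = Q i.+1.
  by move=> ir; rewrite (nth_map 0%N) ?size_iota // nth_iota.
exists [seq Q l | l <- iota 1 r]; rewrite size_map size_iota; split=> //.
  move=> i u u''; rewrite size_map size_iota => ir.
  rewrite !nthQ // => /QP[m Pm <-] /QP[m'' Pm'' <-] _ _ nmm''.
  have nm : m <> m'' by move=> e; rewrite e in nmm''.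
  case: i ir Pm Pm'' => [|i] ir Pm Pm''.
    by case: P1 => a [_ Pa]; rewrite -(Pa m) // -(Pa m'') in nm.
  have [[|j] [u' [//= ji Pu']]] := P2 i.+2 m m'' ir Pm Pm'' nm.
  rewrite -mpolyXD => /ideal_gen_mpolyX[_ <- /mnm_supp_le]; rewrite mnm_suppD => u'mm.
  exists j, (mnm_supp u'); split=> //.
  by rewrite nthQ; [apply/QP; exists u' | lia].
move=> X; apply/coveredP/idP => [[i [u []]]|].
  rewrite size_map size_iota => ir; rewrite nthQ // => /QP[m Pm <-] mX.
  apply: in_supportS mX _; rewrite -mem_mpolyX; apply/genP/ideal_gen_mpolyX.
  by exists m; [exists i.+1 | exact: lepm_refl].
move=> /genP/ideal_gen_mpolyX[m [[|l] //= lr Plm]].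
move=> /mnm_supp_le; rewrite mnm_supp_ind => mX.
exists l, (mnm_supp m); rewrite size_map size_iota; split=> //.
by rewrite nthQ //; apply/QP; exists m.
Qed.

(* Level l consists of the squarefree monomials of degree n + 1 - l in I: the *)
(* lcm of two distinct monomials of the same degree has larger degree.        *)
Lemma schmitt_vogel_exists : ideal_nonzero I -> exists P, schmitt_vogel I n.+1 P.
Proof.
move=> [f fI fn0]; have [A sqfA genA] := sqfI.
(* The product of all variables is to be the single monomial of level 1. *)
have IT : in_support setT.
  have : msupp f != [::] by rewrite msupp_eq0.
  case E: (msupp f) => [//|m s] _.
  apply: in_supportS (subsetT (mnm_supp m)) _; apply: (msupp_in_support fI).
  by rewrite E mem_head.
(* Level [n.+1] is degree 0, which the unit ideal requires. *)
exists (fun l m => exists X, [/\ m = mnm_ind X, in_support X & (#|X| + l = n.+1)%N]).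
split=> [l m _ [X [-> IX _]] //|||].
- exists (mnm_ind setT); split=> [|m [X [-> _]]].
    by exists setT; rewrite cardsT card_ord addn1.
  rewrite addn1 => -[cX]; congr mnm_ind; apply/esym/eqP.
  by rewrite eqEcard subsetT cardsT card_ord cX leqnn.
- move=> l _ _ /andP[l1 ln] [X [-> IX cX]] [Y [-> IY cY]] nXY.
  have cXY : (#|X| < #|X :|: Y|)%N.
    rewrite proper_card // properE subsetUl /=; apply/negP => XYX; apply: nXY.
    congr mnm_ind; apply/esym/eqP; rewrite eqEcard.
    by rewrite (subset_trans (subsetUr X Y) XYX); lia.
  have cn : (#|X :|: Y| <= n)%N by rewrite -[n in (_ <= n)%N]card_ord max_card.
  exists (n.+1 - #|X :|: Y|)%N, (mnm_ind (X :|: Y)); split; first by lia.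
    exists (X :|: Y); split=> //; last by lia.
    by apply: in_supportS IX; exact: subsetUl.
  rewrite -mpolyXD; apply/ideal_gen_mpolyX; exists (mnm_ind (X :|: Y)) => //.
  by rewrite mnm_ind_le mnm_suppD !mnm_supp_ind.
move=> h; split=> [/genA[s hs ->]|[s hs ->]].
  exists s => // t ts; have [a Aa ta] := hs t ts; exists a => //.
  have ca : (#|mnm_supp a| <= n)%N by rewrite -[n in (_ <= n)%N]card_ord max_card.
  exists (n.+1 - #|mnm_supp a|)%N; first by lia.
  exists (mnm_supp a); split; last by lia.
    by rewrite squarefree_ind_supp //; exact: sqfA.
  rewrite -mem_mpolyX; apply/genA/ideal_gen_mpolyX; exists a => //.
  exact: lepm_refl.
rewrite big_seq; apply: rpred_sum => t ts; apply: ideal_mull.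
by have [_ [l _ [X [-> IX _]]] ->] := hs t ts.
Qed.

(** [schmitt_vogel_exists] excludes the default branch of [sv]; the zero ideal gets the empty list
    of levels. *)
Lemma sv_spec :
  exists Ps, [/\ size Ps = sv I, sv_levels setT Ps & covered Ps =1 in_support].
Proof.
rewrite /sv; case: asboolP => [nzI|zI].
  case: pselect => [ex_r|[]]; last first.
    have [P svP] := schmitt_vogel_exists nzI.
    by exists n.+1; apply/andP; split=> //; apply/asboolP; exists P.
  case: ex_minnP => r /andP[_ /asboolP[P svP]] _.
  exact: schmitt_vogel_levels svP.
exists [::]; split=> // X; apply/esym/negP => IX; apply: zI.
exists ('X_[mnm_ind X]) => //.
apply/eqP => /(congr1 (mcoeff (mnm_ind X))) /eqP.
by rewrite mcoeffX mcoeff0 eqxx oner_eq0.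
Qed.

(** Ensures [n.+1 - sv I <= n], as [le_sdepth_ideal] demands. *)
Lemma sv_gt0 : ideal_nonzero I -> (0 < sv I)%N.
Proof.
move=> nzI; rewrite /sv asboolT //; case: pselect => [ex_r|[]].
  by case: ex_minnP => r /andP[].
have [P svP] := schmitt_vogel_exists nzI.
by exists n.+1; apply/andP; split=> //; apply/asboolP; exists P.
Qed.

Lemma poly_part_ind X : poly_part (mdegree (mnm_ind X)) ('X_[mnm_ind X] : S).
Proof. by rewrite -['X_[_]]scale1r; exact: poly_partX. Qed.

Lemma le_sdepth_ideal d D : (d <= n)%N ->
  interval_partition in_support d D -> (d <= sdepth (ideal_part I))%N.
Proof.
move=> dn partD.
pose g X : ideal_module I := insubd (0 : ideal_module I) ('X_[mnm_ind X] : S^o).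
have gE X : in_support X -> ideal_val (g X) = 'X_[mnm_ind X] by exact: insubdK.
apply: (@le_sdepth _ _ _ _ d [seq (g t.1, t.2) | t <- D]) => // [|_ /mapP[t tD ->]].
  apply: (interval_stanley_decomposition (nu := @ideal_val K n I)) partD _ _ _ _ _.
  - by move=> x y; exact: raddfD.
  - exact: val_inj.
  - by move=> x; apply: msupp_in_support; exact: valP.
  - move=> X IX; exists (mdegree (mnm_ind X)).
    by rewrite /ideal_part gE //; exact: poly_part_ind.
  - by move=> X v IX _; rewrite -(gE X IX).
by case: partD => _ _; exact.
Qed.

Lemma le_sdepth_quot d D : (d <= n)%N ->
  interval_partition (predC in_support) d D -> (d <= sdepth (quot_part I))%N.
Proof.
move=> dn partD.
(* [r] is the normal form modulo I: it deletes the monomials in I, so its kernel is I and it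
   descends to an injective map [nu] on the quotient. *)
pose r : S -> S := mpoly_restrict (fun m => predC in_support (mnm_supp m)).
have r0 f : (r f == 0) = (f \in I).
  apply/eqP/idP => [rf|fI].
    apply: mem_ideal_msupp => m; rewrite mcoeff_msupp => mf.
    have /eqP := congr1 (mcoeff m) rf; rewrite mcoeff_restrict mcoeff0 /=.
    by case: in_support => //=; rewrite (negPf mf).
  apply/mpolyP => m; rewrite mcoeff_restrict mcoeff0 /=; case: ifPn => // mI.
  by apply: memN_msupp_eq0; apply: contra mI => mf; exact: msupp_in_support fI _ mf.
have rP f g : reflect (r f = r g) (f - g \in I).
  by rewrite -r0 /r mpoly_restrictB subr_eq0; exact: eqP.
pose nu (x : quot_module I) : S := r (repr (x : Quotient.quot I)).
have nu_pi f : nu (quot_pi I f) = r f.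
  by apply/rP/quot_pi_eq; rewrite /quot_pi reprK.
have nuB : {morph nu : x y / x - y}.
  move=> x y; have [f ->] := quot_pi_surj x; have [h ->] := quot_pi_surj y.
  by rewrite -raddfB !nu_pi /r mpoly_restrictB.
apply: (@le_sdepth _ _ _ _ d
  [seq (quot_pi I 'X_[mnm_ind t.1], t.2) | t <- D]) => // [|_ /mapP[t tD ->]].
  apply: (interval_stanley_decomposition (nu := nu)
    (g := fun X => quot_pi I 'X_[mnm_ind X])) partD _ _ _ _ _.
  - have nu0 : nu 0 = 0 by have := nuB 0 0; rewrite !subrr.
    by move=> x y; rewrite -{1}[y]opprK -[- y]sub0r !nuB nu0 sub0r opprK.
  - move=> x y; have [f ->] := quot_pi_surj x; have [h ->] := quot_pi_surj y.
    by rewrite !nu_pi => /rP/quot_pi_eq.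
  - move=> x m; rewrite mcoeff_msupp mcoeff_restrict.
    by case: ifP => // _; rewrite eqxx.
  - move=> X _; exists (mdegree (mnm_ind X)); exists 'X_[mnm_ind X] => //.
    exact: poly_part_ind.
  - by move=> X v _ vX; rewrite -quot_piZ nu_pi; exact: mpoly_restrict_id.
by case: partD => _ _; exact.
Qed.

End SquarefreeIdeal.

Theorem theorem3p6 (K : fieldType) (n : nat) (I : ideal {mpoly K[n]})
  (hI : squarefree_monomial_ideal I) :
  (ideal_nonzero I ->
     n%:Z - (sv I)%:Z + 1 <= (sdepth (ideal_part I))%:Z) /\
  (ideal_proper I ->
     n%:Z - (sv I)%:Z <= (sdepth (quot_part I))%:Z).
Proof.
have [Ps [szPs svPs covPs]] := sv_spec hI; split=> [nzI|_].
  have [D] := covered_partition svPs; rewrite card_ord szPs => -[cD sD dD].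
  have sv0 := sv_gt0 hI nzI.
  (* Truncated subtraction is never below the integer difference. *)
  suff : (n.+1 - sv I <= sdepth (ideal_part I))%N by lia.
  apply: (le_sdepth_ideal hI (D := D)); first by lia.
  by split=> // X; rewrite cD covPs.
have [D] := uncovered_partition (sub0set _) svPs.
rewrite cardsT card_ord szPs => -[cD sD dD].
suff : (n - sv I <= sdepth (quot_part I))%N by lia.
apply: (le_sdepth_quot hI (D := D)); first exact: leq_subr.
by split=> // X; rewrite cD covPs sub0set subsetT.
Qed.
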